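(* Let $p>5$ be a prime. Then $$\sum_{k=0}^{p-1}\frac{F_k}{12^k}\binom{2k}k\equiv\begin{cases}0\pmod p&\text{if } p\equiv\pm1\pmod 5,\\1\pmod p&\text{if } p\equiv \pm13\pmod{30},\\-1\pmod p&\text{if } p\equiv\pm7\pmod{30}.\end{cases}$$ Also, $$\sum_{k=0}^{p-1}\frac{L_k}{12^k}\binom{2k}k\equiv\begin{cases}-1\pmod p&\text{if } p\equiv\pm7\pmod{30},\\1\pmod p&\text{if } p\equiv \pm13\pmod{30},\\2\pmod p&\text{if } p\equiv\pm1\pmod{30},\\-2\pmod p&\text{if } p\equiv\pm11\pmod{30}.\end{cases}$$
   Context: $F_n$ and $L_n$ are the Fibonacci and Lucas numbers: $F_0=0,F_1=1$, $L_0=2,L_1=1$, and $X_{n+1}=X_n+X_{n-1}$. Congruences between rationals with denominators prime to $p$ are understood in the ring of such rationals. *)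

(* Defs.v *)
From HB Require Import structures.
From mathcomp Require Import all_boot all_order all_algebra.

Set Implicit Arguments.
Unset Strict Implicit.
Unset Printing Implicit Defensive.

Import Order.TTheory GRing.Theory Num.Theory.

Fixpoint fib (n : nat) : nat :=
  match n with
  | 0 => 0
  | 1 => 1
  | (m.+1 as n').+1 => fib n' + fib m
  end.

Fixpoint lucas (n : nat) : nat :=
  match n with
  | 0 => 2
  | 1 => 1
  | (m.+1 as n').+1 => lucas n' + lucas m
  end.

Local Open Scope ring_scope.

(* [denq x] is the positive denominator of [x] in lowest terms. *)
Definition p_integral (p : nat) (x : rat) : bool := coprime `|denq x| p.

(* Congruence modulo the ideal generated by [p] in the ring of rationals whose
   denominators are prime to [p]; both sides are required to lie in the ring. *)
Definition ratcong (p : nat) (x y : rat) : Prop :=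
  [/\ p_integral p x, p_integral p y &
      exists2 z : rat, p_integral p z & x - y = p%:R * z].

(* [n] is congruent to [a] or [- a] modulo [m], as integers. *)
Definition congr_pm (n a m : nat) : Prop :=
  (n%:Z = a%:Z %[mod m%:Z])%Z \/ (n%:Z = - a%:Z %[mod m%:Z])%Z.

(* Main.v *)
(* In characteristic [p = 2n + 1] one has [C(2k, k) = (-4)^k C(n, k)] for
   [k < p], so [\sum_(k < p) C(2k, k) x^k = (1 - 4x)^n].  Adjoin a fifth root of
   unity [z] and a cube root of unity [w], both nontrivial.  The roots of
   [X^2 - X - 1] are [a = - (z^2 + z^3)] and [b = - (z + z^4)], and
   [1 - a/3 = ((z^2 - z^3) / (w - w^2))^2],
   [1 - b/3 = ((z - z^4) / (w - w^2))^2].  Hence the sums attached to [x = a/12]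
   and [x = b/12] are [(p - 1)]-st powers, which Frobenius evaluates in terms
   of [p] modulo 5 and modulo 3; Binet's formulas conclude. *)
Require Import Defs.
From mathcomp Require Import all_boot all_order all_algebra all_field.
From mathcomp Require Import ring zify.
Set Implicit Arguments.
Unset Strict Implicit.
Import Order.TTheory GRing.Theory Num.Theory.
Local Open Scope ring_scope.

(** * From an equality in characteristic p to a congruence of rationals *)

Lemma p_integral_frac (p d : nat) (m : int) :
  (0 < d)%N -> coprime d p -> p_integral p (m%:~R / d%:R).
Proof.
move=> d_gt0 copdp; rewrite /p_integral; set x := _ / _.
have d_neq0 : d%:R != 0 :> rat by rewrite pnatr_eq0 -lt0n.
have eq_x : numq x * d%:Z = m * denq x.
  apply: (@intr_inj rat); rewrite !intrM /= -[x in numq x]/x.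
  by rewrite numqE mulrAC /x divfK.
apply: (@coprime_dvdl _ d) => //.
(* Since [numq x] and [denq x] are coprime, [denq x] divides [d]. *)
have : (denq x %| numq x * d%:Z)%Z by rewrite eq_x dvdz_mull.
rewrite Gauss_dvdzr //.
by rewrite coprimezE coprime_sym coprime_num_den.
Qed.

(** Stated over any field so that the sum in [rat] and its image in characteristic p get the same
    natural numerator over [d ^ m]. *)
Lemma sum_expn_frac (F : fieldType) (d m : nat) (u v : nat -> nat) :
  d%:R != 0 :> F ->
  \sum_(0 <= k < m) (u k)%:R / d%:R ^+ k * (v k)%:R =
  (\sum_(0 <= k < m) u k * d ^ (m - k) * v k)%N%:R / (d ^ m)%N%:R :> F.
Proof.
move=> d_neq0; rewrite natr_sum mulr_suml; apply: eq_big_nat => k /andP[_ km].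
rewrite !natrM !natrX -{2}(subnK (ltnW km)) exprD.
by field; rewrite !expf_neq0.
Qed.

(** With the common denominator [d ^ p] cleared, the equality in [K] says that an integer vanishes
    in characteristic p, hence is divisible by p; its quotient by p, over [d ^ p], witnesses the
    congruence. *)
Lemma ratcong_sum_expn (K : fieldType) (p d : nat) (u v : nat -> nat) (c : int) :
  p \in [pchar K] -> coprime d p ->
  \sum_(0 <= k < p) (u k)%:R / d%:R ^+ k * (v k)%:R = c%:~R :> K ->
  ratcong p (\sum_(0 <= k < p) (u k)%:R / d%:R ^+ k * (v k)%:R) c%:~R.
Proof.
move=> pcharK copdp.
have p_prime := pcharf_prime pcharK.
have d_gt0 : (0 < d)%N.
  by case: d copdp => //; rewrite /coprime gcd0n => /eqP p1; rewrite p1 in p_prime.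
have dK : d%:R != 0 :> K.
  by rewrite -(dvdn_pcharf pcharK) -prime_coprime // coprime_sym.
have dQ : d%:R != 0 :> rat by rewrite pnatr_eq0 -lt0n.
have dp_gt0 : (0 < d ^ p)%N by rewrite expn_gt0 d_gt0.
have copdpp : coprime (d ^ p) p by rewrite coprimeXl.
have dpK : (d ^ p)%N%:R != 0 :> K by rewrite natrX expf_neq0.
have dpQ : (d ^ p)%N%:R != 0 :> rat by rewrite natrX expf_neq0.
rewrite !sum_expn_frac //; set N := (\sum_(0 <= k < p) _)%N => eqN.
have /dvdzP[q eq_q] : (p%:Z %| N%:Z - c * (d ^ p)%N%:Z)%Z.
  have : (N%:Z - c * (d ^ p)%N%:Z)%:~R = 0 :> K.
    by rewrite intrB intrM -eqN divfK ?subrr.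
  case: (N%:Z - _) => m /eqP.
    by rewrite -[_ == 0]/(m%:R == 0 :> K) -(dvdn_pcharf pcharK) dvdzE.
  rewrite NegzE mulrNz oppr_eq0 -[_ == 0]/(m.+1%:R == 0 :> K).
  by rewrite -(dvdn_pcharf pcharK) dvdzE abszN.
split.
- by rewrite -[N%:R]/(N%:Z%:~R) p_integral_frac.
- by rewrite -[c%:~R]divr1 -[1]/(1%N%:R) p_integral_frac // coprime1n.
exists (q%:~R / (d ^ p)%N%:R); first exact: p_integral_frac.
apply: (mulIf dpQ); rewrite mulrBl divfK // -mulrA divfK // [RHS]mulrC.
by have /(congr1 (fun m : int => m%:~R : rat)) := eq_q; rewrite intrB !intrM.
Qed.

(** * Central binomial coefficients in characteristic p *)

Lemma mul_bin_center (k : nat) :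
  (k.+1 * 'C(2 * k.+1, k.+1) = 2 * (2 * k).+1 * 'C(2 * k, k))%N.
Proof.
have -> : (2 * k.+1 = (2 * k).+2)%N by lia.
rewrite -mul_bin_diag -[in RHS]mulnA (mul_bin_down (2 * k).+1) mulnA.
by congr (_ * _)%N; lia.
Qed.

(** By induction: both sides obey the same recurrence, because 2(2k + 1) = -4(n - k) once 2n = -1,
    and k + 1 is invertible as long as k + 1 < p. *)
Lemma bin_center_pchar (K : fieldType) (p n k : nat) :
  p \in [pchar K] -> p = (2 * n).+1 -> (k < p)%N ->
  ('C(2 * k, k))%:R = (- 4%:R) ^+ k * ('C(n, k))%:R :> K.
Proof.
move=> pcharK eq_p; elim: k => [|k IHk] k_lt_p; first by rewrite !bin0 mul1r.
have k1_neq0 : k.+1%:R != 0 :> K.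
  by rewrite -(dvdn_pcharf pcharK) gtnNdvd.
apply: (mulfI k1_neq0); rewrite -natrM mul_bin_center !natrM IHk; last exact: ltnW.
have -> : k.+1%:R * ((- 4%:R) ^+ k.+1 * 'C(n, k.+1)%:R) =
   (- 4%:R) ^+ k.+1 * (k.+1 * 'C(n, k.+1))%N%:R :> K by rewrite natrM; ring.
rewrite mul_bin_left natrM exprS.
(* The subtraction [n - k] is truncated; when n < k, both sides vanish with C(n, k). *)
have [k_le_n|n_lt_k] := leqP k n; last by rewrite bin_small // !mulr0.
have p0 : 2%:R * n%:R + 1 = 0 :> K.
  by rewrite -natrM natr1 -eq_p pcharf0.
rewrite natrB // -(natr1 (2 * k)%N) natrM; apply: subr0_eq.
set x := _ ^+ k; set y := 'C(n, k)%:R.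
by transitivity ((2%:R * n%:R + 1) * (2%:R * x * y)); [ring | rewrite p0 mul0r].
Qed.

Lemma sum_bin_center_pchar (K : fieldType) (p n : nat) (x : K) :
  p \in [pchar K] -> p = (2 * n).+1 ->
  \sum_(0 <= k < p) ('C(2 * k, k))%:R * x ^+ k = (1 - 4%:R * x) ^+ n.
Proof.
move=> pcharK eq_p.
under eq_big_nat => k /andP[_ kp].
  rewrite (bin_center_pchar pcharK eq_p kp) mulrAC -exprMn; over.
rewrite (big_cat_nat (n := n.+1)) /=; [|lia|lia].
rewrite [X in _ + X]big1_seq ?addr0; last first.
  by move=> k; rewrite mem_index_iota => /= /andP[nk _]; rewrite bin_small ?mulr0.
rewrite exprDn big_mkord; apply: eq_bigr => k _.
by rewrite expr1n mul1r mulr_natr mulNr.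
Qed.

(** * Binet's formulas *)

Lemma fib_binet (R : comRingType) (a b : R) (k : nat) :
  a ^+ 2 = a + 1 -> b ^+ 2 = b + 1 -> (a - b) * (fib k)%:R = a ^+ k - b ^+ k.
Proof.
move=> ha hb.
suff [] : (a - b) * (fib k)%:R = a ^+ k - b ^+ k /\
          (a - b) * (fib k.+1)%:R = a ^+ k.+1 - b ^+ k.+1 by [].
elim: k => [|k [IH0 IH1]]; first by split; rewrite /= ?mulr0 ?subrr ?mulr1.
split=> //; rewrite -[fib k.+2]/(fib k.+1 + fib k)%N natrD mulrDr IH0 IH1.
by rewrite -[k.+2]addn2 !exprD ha hb !exprS; ring.
Qed.

Lemma lucas_binet (R : comRingType) (a b : R) (k : nat) :
  a + b = 1 -> a ^+ 2 = a + 1 -> b ^+ 2 = b + 1 ->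
  (lucas k)%:R = a ^+ k + b ^+ k.
Proof.
move=> hab ha hb.
suff [] : (lucas k)%:R = a ^+ k + b ^+ k /\
          (lucas k.+1)%:R = a ^+ k.+1 + b ^+ k.+1 by [].
elim: k => [|k [IH0 IH1]]; first by rewrite !expr0 !expr1 hab.
split=> //; rewrite -[lucas k.+2]/(lucas k.+1 + lucas k)%N natrD IH0 IH1.
by rewrite -[k.+2]addn2 !exprD ha hb !exprS; ring.
Qed.

(** * Roots of unity, Frobenius, and the values of the sums *)

Lemma pchar_closedField (p : nat) :
  prime p -> exists K : closedFieldType, p \in [pchar K].
Proof.
move=> p_prime; have [K [f _]] := countable_algebraic_closure 'F_p.
by exists K; apply: (rmorph_pchar f); rewrite pchar_Fp.
Qed.

(** Supplies roots of unity through the relation 1 + z + ... + z^(m-1) = 0, modulo which later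
    identities are checked. *)
Lemma closed_sum_expr_root (K : closedFieldType) (m : nat) :
  (1 < m)%N -> exists z : K, \sum_(i < m) z ^+ i = 0.
Proof.
case: m => [//|m] m_gt0; have [z hz] := @solve_monicpoly K m (fun=> -1) m_gt0.
by exists z; rewrite big_ord_recr /= hz -big_split /= big1 // => i _; ring.
Qed.

(** Here (t^2)^((p-1)/2) = t^(p-1), written as a quotient so that Frobenius can evaluate
    [t ^+ p]. *)
Lemma sum_bin_center_sqr (K : fieldType) (p : nat) (t x : K) :
  p \in [pchar K] -> odd p -> t != 0 -> 1 - 4%:R * x = t ^+ 2 ->
  \sum_(0 <= k < p) ('C(2 * k, k))%:R * x ^+ k = t ^+ p / t.
Proof.
move=> pcharK p_odd t0 ht; have eq_p : p = (2 * p./2).+1 by lia.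
rewrite (sum_bin_center_pchar x pcharK eq_p) ht -exprM [in RHS]eq_p.
by rewrite exprS mulrAC divff ?mul1r.
Qed.

(** Frobenius is additive, and z^p depends only on p modulo m. *)
Lemma expr_root1_subX (K : fieldType) (p m i j : nat) (z : K) :
  p \in [pchar K] -> z ^+ m = 1 ->
  (z ^+ i - z ^+ j) ^+ p = z ^+ (p %% m * i) - z ^+ (p %% m * j).
Proof.
move=> pcharK hz; rewrite -(pFrobenius_autE pcharK) rmorphB !rmorphXn /=.
by rewrite pFrobenius_autE -(expr_mod p hz) -!exprM.
Qed.

(** The sign [s] is the Legendre symbol of -3 modulo p. The lists are indexed by p modulo 5; their
    entry 0 is a filler, as p > 5 is prime. *)
Lemma fib_lucas_sums_pchar (K : closedFieldType) (p : nat) (s : int) :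
  p \in [pchar K] -> (5 < p)%N -> s = (if (p %% 3 == 1)%N then 1 else -1) ->
  \sum_(0 <= k < p) (fib k)%:R / 12%:R ^+ k * ('C(2 * k, k))%:R =
    (s * [:: 0; 0; -1; 1; 0]`_(p %% 5))%:~R :> K /\
  \sum_(0 <= k < p) (lucas k)%:R / 12%:R ^+ k * ('C(2 * k, k))%:R =
    (s * [:: 0; 2; -1; 1; -2]`_(p %% 5))%:~R :> K.
Proof.
move=> pcharK p_gt5 eq_s; have p_prime := pcharf_prime pcharK.
have p_odd : odd p by case: (even_prime p_prime) => // p2; rewrite p2 in p_gt5.
have primeK q : prime q -> (q < p)%N -> q%:R != 0 :> K.
  move=> q_prime q_lt_p; rewrite -(dvdn_pcharf pcharK) dvdn_prime2 //.
  by rewrite neq_ltn q_lt_p orbT.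
have K2 : 2%:R != 0 :> K by apply: primeK => //; lia.
have K3 : 3%:R != 0 :> K by apply: primeK => //; lia.
have K5 : 5%:R != 0 :> K by apply: primeK.
have K12 : 12%:R != 0 :> K.
  by rewrite (natrM _ 4 3) (natrM _ 2 2) !mulf_neq0.
have [z hz] := @closed_sum_expr_root K 5 isT.
have [w hw] := @closed_sum_expr_root K 3 isT.
rewrite !big_ord_recr !big_ord0 /= in hz hw.
have z4 : z ^+ 4 = - (1 + z + z ^+ 2 + z ^+ 3) by rewrite -[RHS]addr0 -hz; ring.
have w2 : w ^+ 2 = - (1 + w) by rewrite -[RHS]addr0 -hw; ring.
have z5 : z ^+ 5 = 1 by ring: z4.
have w3 : w ^+ 3 = 1 by ring: w2.
pose a := - (z ^+ 2 + z ^+ 3); pose b := - (z ^+ 1 + z ^+ 4).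
(* The exponents 1 keep [v] and [c] in the form required by [expr_root1_subX]. *)
pose u := z ^+ 2 - z ^+ 3; pose v := z ^+ 1 - z ^+ 4; pose c := w ^+ 1 - w ^+ 2.
have ab1 : a + b = 1 by rewrite /a /b; ring: z4.
have a2 : a ^+ 2 = a + 1 by rewrite /a; ring: z4.
have b2 : b ^+ 2 = b + 1 by rewrite /b; ring: z4.
have s5 : (a - b) ^+ 2 = 5%:R by rewrite /a /b; ring: z4.
have c2 : c ^+ 2 = - 3%:R by rewrite /c; ring: w2.
have u2 : u ^+ 2 = a - 3%:R by rewrite /u /a; ring: z4.
have v2 : v ^+ 2 = b - 3%:R by rewrite /v /b; ring: z4.
(* Frobenius exchanges [u] and [v] up to sign when p is 2 or 3 modulo 5; these relations turn the
   exchange into a scaling. *)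
have eq_v : v = a * u by rewrite /v /u /a; ring: z4.
have eq_u : u = - b * v by rewrite /v /u /b; ring: z4.
have ab_neq0 : a - b != 0 by rewrite -sqrf_eq0 s5.
have c_neq0 : c != 0 by rewrite -sqrf_eq0 c2 oppr_eq0.
have uv5 : (u * v) ^+ 2 = 5%:R by rewrite exprMn u2 v2 /a /b; ring: z4.
have /andP[u_neq0 v_neq0] : (u != 0) && (v != 0).
  by rewrite -negb_or -mulf_eq0 -sqrf_eq0 uv5.
have cp : c ^+ p = s%:~R * c.
  rewrite (expr_root1_subX _ _ pcharK w3) eq_s /c.
  have : (p %% 3 != 0)%N.
    by rewrite -/(dvdn 3 p) dvdn_prime2 // neq_ltn (ltn_trans _ p_gt5).
  have := ltn_pmod p (isT : 0 < 3)%N.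
  by case: (p %% 3)%N => [|[|[|//]]] //= _ _; ring: w2.
have s2 : s%:~R * s%:~R = 1 :> K by rewrite eq_s; case: ifP => _; ring.
(* Dividing by [c] costs only the factor 1/s, which is s because s^2 = 1. *)
have powc (t : K) : (t / c) ^+ p / (t / c) = s%:~R * (t ^+ p / t).
  have s_neq0 : s%:~R != 0 :> K.
    by apply: contraTneq (oner_neq0 K) => s0; rewrite -s2 s0 mulr0 eqxx.
  have -> : s%:~R = s%:~R^-1 :> K by apply: (mulfI s_neq0); rewrite s2 divff.
  have [->|t_neq0] := eqVneq t 0; first by rewrite !(invr0, mul0r, mulr0).
  rewrite expr_div_n cp; field; by rewrite c_neq0 t_neq0 s_neq0.
have sumE (t x : K) : t != 0 -> t ^+ 2 = x - 3%:R ->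
    \sum_(0 <= k < p) ('C(2 * k, k))%:R * (x / 12%:R) ^+ k =
    s%:~R * (t ^+ p / t).
  move=> t_neq0 t2; rewrite -powc; apply: sum_bin_center_sqr => //.
    by rewrite mulf_neq0 ?invr_eq0.
  (* 1 - 4(x/12) = (x - 3)/(-3) = (t/c)^2. *)
  rewrite expr_div_n t2 c2; field; by rewrite oppr_eq0 K12 K3.
have sumLE : \sum_(0 <= k < p) (lucas k)%:R / 12%:R ^+ k * ('C(2 * k, k))%:R =
    s%:~R * (u ^+ p / u + v ^+ p / v).
  rewrite mulrDr -(sumE _ _ u_neq0 u2) -(sumE _ _ v_neq0 v2) -big_split /=.
  by apply: eq_bigr => k _; rewrite (lucas_binet k ab1 a2 b2) !expr_div_n; ring.
have sumFE : (a - b) *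
    (\sum_(0 <= k < p) (fib k)%:R / 12%:R ^+ k * ('C(2 * k, k))%:R) =
    s%:~R * (u ^+ p / u - v ^+ p / v).
  rewrite mulrBr -(sumE _ _ u_neq0 u2) -(sumE _ _ v_neq0 v2) -sumrB mulr_sumr.
  apply: eq_bigr => k _; rewrite !mulrA (fib_binet k a2 b2) !expr_div_n; ring.
(* The scalars [x] and [y] are u^(p-1) and v^(p-1); up to the sign [s], the Lucas sum is x + y and
   the Fibonacci sum is (x - y)/(a - b). *)
rewrite {}sumLE; suff [x [y [xP yP fibP lucasP]]] : exists x y,
    [/\ u ^+ p = x * u, v ^+ p = y * v,
      x - y = (a - b) * ([:: 0; 0; -1; 1; 0]`_(p %% 5))%:~R
      & x + y = ([:: 0; 2; -1; 1; -2]`_(p %% 5))%:~R].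
  split; last by rewrite xP yP !mulfK // lucasP intrM.
  by apply: (mulfI ab_neq0); rewrite sumFE xP yP !mulfK // fibP intrM mulrCA.
rewrite !(expr_root1_subX _ _ pcharK z5).
have p5_neq0 : (p %% 5 != 0)%N.
  by rewrite -/(dvdn 5 p) dvdn_prime2 // neq_ltn p_gt5.
have := ltn_pmod p (isT : 0 < 5)%N.
case: (p %% 5)%N p5_neq0 => [|[|[|[|[|//]]]]] //= _ _.
- by exists 1, 1; split; rewrite ?mul1r //; ring.
- exists (- a), (- b); split; last 2 first.
  + by rewrite /= ; ring.
  + by rewrite -opprD ab1.
  + by rewrite mulNr -eq_v /v; ring: z4.
  + by rewrite -eq_u /u; ring: z4.
- exists a, b; split; last 2 first.
  + by rewrite /= ; ring.
  + by rewrite ab1.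
  + by rewrite -eq_v /v; ring: z4.
  + by rewrite -[b]opprK mulNr -eq_u /u; ring: z4.
- exists (- 1), (- 1); split; rewrite /u /v; ring: z4.
Qed.

Theorem theorem1p5 (p : nat) (p_prime : prime p) (p_gt5 : (5 < p)%N) :
  let SF : rat :=
    \sum_(0 <= k < p) (fib k)%:R / 12%:R ^+ k * ('C(2 * k, k))%:R in
  let SL : rat :=
    \sum_(0 <= k < p) (lucas k)%:R / 12%:R ^+ k * ('C(2 * k, k))%:R in
  [/\ congr_pm p 1 5 -> ratcong p SF 0,
      congr_pm p 13 30 -> ratcong p SF 1
    & congr_pm p 7 30 -> ratcong p SF (-1)]
  /\
  [/\ congr_pm p 7 30 -> ratcong p SL (-1),
      congr_pm p 13 30 -> ratcong p SL 1,
      congr_pm p 1 30 -> ratcong p SL 2%:R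
    & congr_pm p 11 30 -> ratcong p SL (- 2%:R)].
Proof.
have [K pcharK] := pchar_closedField p_prime.
have [sumF sumL] := fib_lucas_sums_pchar pcharK p_gt5 erefl.
have cop12p : coprime 12 p.
  rewrite coprime_sym prime_coprime // (Euclid_dvdM 4 3) // (Euclid_dvdM 2 2) //.
  by rewrite orbb !gtnNdvd //; lia.
have {sumF} := ratcong_sum_expn pcharK cop12p sumF.
have {sumL} := ratcong_sum_expn pcharK cop12p sumL.
move=> sumL sumF SF SL; rewrite /congr_pm.
(* With the residues as variables, the list entry and the sign compute once they are given as
   numerals. *)
have residues r5 r3 : (p %% 5 = r5)%N -> (p %% 3 = r3)%N ->
    ratcong p SF ((if (r3 == 1)%N then 1 else -1) * [:: 0; 0; -1; 1; 0]`_r5)%:~R /\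
    ratcong p SL ((if (r3 == 1)%N then 1 else -1) * [:: 0; 2; -1; 1; -2]`_r5)%:~R.
  by move=> <- <-.
split.
- split.
  (* For p = 1 or 4 modulo 5 the list entry is 0, whatever the sign. *)
  + case=> h.
      by have [|//|+ _] := residues 1 (p %% 3)%N; [lia | rewrite mulr0].
    by have [|//|+ _] := residues 4 (p %% 3)%N; [lia | rewrite mulr0].
  (* 13 is 3 modulo 5 and 1 modulo 3, while -13 is 2 modulo both: list entry and sign change
     together, so their product is the same. The other classes modulo 30 are split likewise. *)
  + by case=> h; [case: (residues 3 1) | case: (residues 2 2)]; lia || done.
  + by case=> h; [case: (residues 2 1) | case: (residues 3 2)]; lia || done.
- split.
  + by case=> h; [case: (residues 2 1) | case: (residues 3 2)]; lia || done.
  + by case=> h; [case: (residues 3 1) | case: (residues 2 2)]; lia || done.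
  + by case=> h; [case: (residues 1 1) | case: (residues 4 2)]; lia || done.
  + by case=> h; [case: (residues 1 2) | case: (residues 4 1)]; lia || done.
Qed.
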